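(* Let $k\ge 2$ be an integer. Then $\mathrm{r}_{\binom{k}{2}}(12\cdots k)$ equals the number of pairs $(P,Q)$ of standard Young tableaux, both of staircase shape $(k-1,k-2,\dots,1)$, such that $P$ has increasing diagonals, i.e. for all $2\le r\le k-1$ and $1\le c\le k-2$ (whenever both cells exist), the entry of $P$ in row $r$, column $c$ is less than the entry of $P$ in row $r-1$, column $c+1$.
   Context: $\mathcal{S}_n$ is the set of permutations of $[n]$, $\pi^r=\pi_n\cdots\pi_1$ is the reversal of $\pi=\pi_1\cdots\pi_n$. A word $w=w_1\cdots w_m$ contains $\rho\in\mathcal{S}_k$ if there are indices $i_1<\cdots<i_k$ with $w_{i_a}\le w_{i_b}$ iff $\rho_a\le\rho_b$; otherwise it avoids $\rho$. $\mathcal{R}_n=\{\pi\pi^r:\pi\in\mathcal{S}_n\}$ (concatenation), $\mathcal{R}_n(\rho)$ is the set of its members avoiding $\rho$, and $\mathrm{r}_n(\rho)=|\mathcal{R}_n(\rho)|$. Tableaux are in English notation (rows indexed top to bottom, row 1 the longest). *)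

(* Defs.v *)
From mathcomp Require Import all_boot all_fingroup.

Set Implicit Arguments.
Unset Strict Implicit.
Unset Printing Implicit Defensive.

(* The set [n] = {1, ..., n} is represented throughout by
   'I_n = {0, ..., n-1}: positions, letters and tableau entries are all shifted
   down by one, which preserves every comparison used below. *)

Definition perm_word (n : nat) (p : 'S_n) : n.-tuple 'I_n :=
  [tuple p i | i < n].

(* The words pi pi^r, collected as a set of words of length 2n, so that the
   cardinality below counts distinct words. *)
Definition reverse_double_list (n : nat) : {set (n + n).-tuple 'I_n} :=
  [set [tuple of perm_word p ++ rev (perm_word p)] | p : 'S_n].

(* The "iff" on weak comparisons forces distinct pattern letters to be matched
   with distinct letters of w. *)
Definition contains (m n k : nat) (w : m.-tuple 'I_n) (rho : 'S_k) : bool :=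
  [exists f : {ffun 'I_k -> 'I_m},
     [forall a : 'I_k, forall b : 'I_k, (a < b) ==> (f a < f b)] &&
     [forall a : 'I_k, forall b : 'I_k,
        (tnth w (f a) <= tnth w (f b)) == (rho a <= rho b)]].

Definition avoids (m n k : nat) (w : m.-tuple 'I_n) (rho : 'S_k) : bool :=
  ~~ contains w rho.

Definition r_avoid (n k : nat) (rho : 'S_k) : nat :=
  #|[set w in reverse_double_list n | avoids w rho]|.

(* A shape is the sequence of its row lengths, from the top row down. *)
Definition cell (lam : seq nat) : finType :=
  {i : 'I_(size lam) & 'I_(nth 0 lam i)}.

Definition row_of (lam : seq nat) (c : cell lam) : nat := tag c.
Definition col_of (lam : seq nat) (c : cell lam) : nat := tagged c.

Definition filling (lam : seq nat) : finType :=
  {ffun cell lam -> 'I_(sumn lam)}.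

Definition standard (lam : seq nat) (T : filling lam) : bool :=
  [&& [forall v : 'I_(sumn lam), #|[set c : cell lam | T c == v]| == 1],
      [forall c : cell lam, forall d : cell lam,
         (row_of c == row_of d) && (col_of c < col_of d) ==> (T c < T d)]
    & [forall c : cell lam, forall d : cell lam,
         (col_of c == col_of d) && (row_of c < row_of d) ==> (T c < T d)]].

(* d is the cell immediately above and to the right of c. *)
Definition increasing_diagonals (lam : seq nat) (T : filling lam) : bool :=
  [forall c : cell lam, forall d : cell lam,
     (row_of c == (row_of d).+1) && (col_of d == (col_of c).+1)
       ==> (T c < T d)].

(* (k-1, k-2, ..., 1) *)
Definition staircase (k : nat) : seq nat := rev (iota 1 k.-1).

(* Main.v *)
(* For a position i of pi let a(i) and b(i) be the lengths, minus one, of the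
   longest increasing and longest decreasing subsequences of pi ending at i.
   A strictly increasing subsequence of pi pi^r is an increasing subsequence of
   pi followed by a decreasing one read backwards, so pi pi^r avoids 12...k iff
   a(i) + b(i) < k - 1 for all i.  As in the Erdos-Szekeres theorem, (a, b) is
   injective, and the staircase has exactly C(k, 2) cells, so i -> (b(i), a(i))
   is a bijection from positions to cells (row, column).  Writing i in its cell
   gives Q; writing pi(i) there and reflecting each column of the staircase gives
   P.  Conversely, the tableau conditions on (P, Q) force the coordinates of the
   cells to be the functions a and b of the permutation read off from (P, Q). *)
Require Import Defs.
From mathcomp Require Import all_boot all_fingroup.
From mathcomp Require Import zify.

Set Implicit Arguments.
Unset Strict Implicit.
Unset Printing Implicit Defensive.

(** * Comparing cardinalities through a relation *)

(** Choosing a related [y] for each [x] gives a map that is injective on [A]. Only a relation is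
    asked for, so one relation can serve for both inequalities of the count. *)
Lemma leq_card_rel (T U : finType) (A : {set T}) (B : {set U})
    (R : T -> U -> Prop) :
  (forall x, x \in A -> exists2 y, y \in B & R x y) ->
  (forall x x' y, x \in A -> x' \in A -> y \in B ->
     R x y -> R x' y -> x = x') ->
  #|A| <= #|B|.
Proof.
move=> exR injR; case: (set_0Vmem A) => [->|[x0 Ax0]]; first by rewrite cards0.
have [y0 _ _] := exR x0 Ax0.
have /fin_all_exists[f fP] x : exists y, x \in A -> y \in B /\ R x y.
  case: (boolP (x \in A)) => [/exR[y By Rxy]|_]; last by exists y0.
  by exists y.
rewrite -(@card_in_imset _ _ f (mem A)); last first.
  move=> x x' Ax Ax' eqf; have [By Rxy] := fP x Ax; have [_ Rxy'] := fP x' Ax'.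
  by apply: (injR x x' (f x)) => //; rewrite eqf.
by apply/subset_leq_card/subsetP => _ /imsetP[x Ax ->]; case: (fP x Ax).
Qed.

(** * Lengths of longest chains *)

(** Local characterization of the number of steps in a longest [e]-chain ending at a point. It can
    be checked on tableau coordinates without mentioning chains. *)
Definition height_fun (I : Type) (e : I -> I -> bool) (h : I -> nat) : Prop :=
  (forall x y, e x y -> h x < h y) /\
  (forall y, 0 < h y -> exists2 x, e x y & h y = (h x).+1).

Section Height.
Variables (I : finType) (e : rel I).

(** Descend from [x] through predecessors that lower [h] by exactly one: each step lowers [h'] by at
    least one. *)
Lemma height_fun_leq (h h' : I -> nat) (hh : height_fun e h)
    (hh' : height_fun e h') (x : I) : h x <= h' x.
Proof.
move eqm : (h x) => m; elim: m x eqm => [//|m IHm] x eqm.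
have [|y eyx hx] := proj2 hh x; first by rewrite eqm.
have := IHm y; have := proj1 hh' _ _ eyx; lia.
Qed.

Lemma height_fun_unique (h h' : I -> nat) :
  height_fun e h -> height_fun e h' -> h =1 h'.
Proof.
by move=> hh hh' x; apply/eqP; rewrite eqn_leq !(height_fun_leq _ _ x).
Qed.

(** Longest chain ending at [x] among those with at most [m] steps. *)
Fixpoint height (m : nat) (x : I) : nat :=
  if m is m'.+1 then \max_(y | e y x) (height m' y).+1 else 0.

(** A chain ending at [x] has at most [f x] steps, so a larger bound on the number of steps changes
    nothing. *)
Lemma height_stable (f : I -> nat) (m : nat) (x : I) :
  (forall x y, e x y -> f x < f y) -> f x < m -> height m x = height m.+1 x.
Proof.
move=> fe; elim: m x => [//|m IHm] x ltfm /=.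
by apply: eq_bigr => y /fe ltf; rewrite IHm //; lia.
Qed.

Lemma height_fun_exists (f : I -> nat) (m : nat) :
    (forall x y, e x y -> f x < f y) -> (forall x, f x < m) ->
  exists h, height_fun e h.
Proof.
move=> fe fm; exists (height m); split=> [x y exy|y].
  rewrite [height m y](height_stable fe) //=.
  exact: (@leq_bigmax_cond _ (fun x => e x y) (fun x => (height m x).+1)).
rewrite [height m y](height_stable fe) //= => h_gt0.
case: (pickP (fun x => e x y)) => [x0 ex0|none]; last by rewrite big_pred0 in h_gt0.
have [|x ex ->] := @eq_bigmax_cond _ (fun x => e x y) (fun x => (height m x).+1).
  by apply/card_gt0P; exists x0.
by exists x.
Qed.

Lemma height_chain (h : I -> nat) (x : I) : height_fun e h ->
  exists2 f : nat -> I, f (h x) = x & forall i, i < h x -> e (f i) (f i.+1).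
Proof.
move=> hh; move eqm : (h x) => m.
elim: m x eqm => [|m IHm] x eqm; first by exists (fun=> x).
have [|y eyx hx] := proj2 hh x; first by rewrite eqm.
have [|f fm fe] := IHm y; first by lia.
exists (fun i => if i <= m then f i else x); first by rewrite ltnn.
move=> i; rewrite ltnS => lim; rewrite lim.
case: (ltnP i m) => [/fe //|lemi].
by have -> : i = m by [lia]; rewrite fm.
Qed.

End Height.

Lemma chain_homo (I : Type) (e : I -> I -> bool) (f : nat -> I) (m i j : nat) :
    (forall x y z, e x y -> e y z -> e x z) ->
    (forall i, i < m -> e (f i) (f i.+1)) ->
  i < j <= m -> e (f i) (f j).
Proof.
move=> etr fe /andP[]; elim: j => [//|j IHj] ltij lejm.
case: (ltnP i j) => [ltij'|leji].
  by apply: etr (IHj ltij' (ltnW lejm)) (fe _ lejm).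
by have -> : i = j by [lia]; apply: fe.
Qed.

(** * Ascents, descents and reverse double words *)

Definition ascent (n : nat) (p : 'S_n) : rel 'I_n :=
  fun i j => (i < j) && (p i < p j).
Definition descent (n : nat) (p : 'S_n) : rel 'I_n :=
  fun i j => (i < j) && (p j < p i).

Lemma ascent_trans (n : nat) (p : 'S_n) x y z :
  ascent p x y -> ascent p y z -> ascent p x z.
Proof. by rewrite /ascent; lia. Qed.

Lemma descent_trans (n : nat) (p : 'S_n) x y z :
  descent p x y -> descent p y z -> descent p x z.
Proof. by rewrite /descent; lia. Qed.

Lemma perm_neq_val (n : nat) (p : 'S_n) (i j : 'I_n) :
  i != j -> (p i : nat) != p j.
Proof. by apply: contra => /eqP/val_inj/perm_inj->. Qed.

Definition double_word (n : nat) (p : 'S_n) : (n + n).-tuple 'I_n :=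
  [tuple of perm_word p ++ rev (perm_word p)].

Lemma tnth_double_lshift (n : nat) (p : 'S_n) (i : 'I_n) :
  tnth (double_word p) (lshift n i) = p i.
Proof. by rewrite tnth_lshift tnth_mktuple. Qed.

Lemma tnth_double_rshift (n : nat) (p : 'S_n) (i : 'I_n) :
  tnth (double_word p) (rshift n i) = p (rev_ord i).
Proof.
rewrite tnth_rshift (tnth_nth (p i)) [LHS]nth_rev size_tuple //.
by rewrite -[n - i.+1]/(val (rev_ord i)) -tnth_nth tnth_mktuple.
Qed.

Lemma double_word_inj (n : nat) : injective (@double_word n).
Proof.
move=> p q eqpq; apply/permP => i.
by rewrite -!tnth_double_lshift eqpq.
Qed.

Lemma r_avoidE (n k : nat) (rho : 'S_k) :
  r_avoid n rho = #|[set p : 'S_n | avoids (double_word p) rho]|.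
Proof.
rewrite -(card_imset _ (@double_word_inj n)); apply: eq_card => w.
rewrite inE; apply/andP/imsetP => [[/imsetP[p _ ->] av]|[p]].
  by exists p; rewrite ?inE.
by rewrite inE => av ->; split=> //; apply/imsetP; exists p.
Qed.

Lemma contains_id (m n k : nat) (w : m.-tuple 'I_n) :
  reflect (exists f : 'I_k -> 'I_m, forall a b : 'I_k, a < b ->
             f a < f b /\ tnth w (f a) < tnth w (f b))
          (contains w (1%g : 'S_k)).
Proof.
apply: (iffP existsP) => [[f /andP[/forallP f1 /forallP f2]]|[f fP]].
  exists f => a b ltab; split.
    by have /forallP/(_ b) := f1 a; rewrite ltab.
  (* Taking the pair in the order [b], [a] makes the pattern side false, which gives a strict
     inequality of letters. *)
  have /forallP/(_ a)/eqP := f2 b; rewrite !perm1 [b <= a]leqNgt ltab /=.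
  by rewrite ltnNge => ->.
exists [ffun a => f a]; apply/andP; split; apply/forallP => a; apply/forallP=> b.
  by apply/implyP => /fP[]; rewrite !ffunE.
rewrite !ffunE !perm1; case: (ltngtP a b) => [/fP[]|/fP[]|/val_inj->]; lia.
Qed.

(** * Avoidance in terms of heights *)

Section Avoid.
Variables (n k : nat) (p : 'S_n) (a b : 'I_n -> nat).
Hypotheses (ha : height_fun (ascent p) a) (hb : height_fun (descent p) b).

(** The Erdős-Szekeres argument: if [j] came first, the pair would be an ascent or a descent from
    [j] to [i], forcing [a j < a i] or [b j < b i]. *)
Lemma pos_lt (i j : 'I_n) : a i <= a j -> b i <= b j -> i != j -> i < j.
Proof.
move=> leij lebij neij; have := perm_neq_val p neij.
case: (ltngtP i j) => [//|ltji|/val_inj eqij]; last by rewrite eqij eqxx in neij.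
rewrite neq_ltn => /orP[] ltp.
  by have := proj1 hb j i; rewrite /descent ltji ltp => /(_ isT); lia.
by have := proj1 ha j i; rewrite /ascent ltji ltp => /(_ isT); lia.
Qed.

Lemma val_lt (i j : 'I_n) : a i <= a j -> b j <= b i -> i != j -> p i < p j.
Proof.
move=> leij lebij neij; have := perm_neq_val p neij.
rewrite neq_ltn => /orP[//|ltp].
case: (ltngtP i j) => [ltij|ltji|/val_inj eqij]; last by rewrite eqij eqxx in neij.
  by have := proj1 hb i j; rewrite /descent ltij ltp => /(_ isT); lia.
by have := proj1 ha j i; rewrite /ascent ltji ltp => /(_ isT); lia.
Qed.

Lemma avoids_height : 0 < k ->
  reflect (forall i, (a i + b i).+1 < k)
          (avoids (double_word p) (1%g : 'S_k)).
Proof.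
move=> k_gt0; apply: (iffP idP) => [av i|hab].
  rewrite ltnNge; apply: contra av => lek; apply/contains_id.
  have [f fa fe] := height_chain i ha; have [g gb ge] := height_chain i hb.
  have fP x y : x < y <= a i -> ascent p (f x) (f y).
    exact: chain_homo (@ascent_trans n p) fe.
  have gP x y : x < y <= b i -> descent p (g x) (g y).
    exact: chain_homo (@descent_trans n p) ge.
  (* The ascending chain up to [i] lies in the first half; the descending chain, read backwards from
     just before [i], lies in the reversed half. Together they have [a i + b i + 1 >= k] letters,
     with [i] used once. *)
  exists (fun x : 'I_k => if x <= a i then lshift n (f x)
                          else rshift n (rev_ord (g (a i + b i - x)))).
  move=> x y ltxy; have ltyk := ltn_ord y.
  case: (leqP y (a i)) => [ley|lty].
    rewrite (leq_trans (ltnW ltxy) ley) !tnth_double_lshift /=.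
    by have /andP[] := fP x y (introT andP (conj ltxy ley)).
  rewrite tnth_double_rshift rev_ordK.
  case: (leqP x (a i)) => [lex|ltx].
    rewrite tnth_double_lshift; split; first by rewrite /= ltn_addr.
    have /andP[_ lt_i] : descent p (g (a i + b i - y)) i.
      by have := gP (a i + b i - y) (b i); rewrite gb; apply; lia.
    apply: leq_ltn_trans lt_i; case: (ltngtP x (a i)) lex => // [ltxa _|-> _].
      have /andP[_ /ltnW] : ascent p (f x) (f (a i)) by apply: fP; rewrite ltxa /=.
      by rewrite fa.
    by rewrite fa.
  rewrite tnth_double_rshift rev_ordK.
  have /andP[ltg ltpg] : descent p (g (a i + b i - y)) (g (a i + b i - x)).
    by apply: gP; lia.
  split=> //=; move: ltg (ltn_ord (g (a i + b i - x))); lia.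
apply/contains_id => -[f fP].
(* Both halves of the word are graded by the interval [0, k - 2]. *)
pose phi (u : 'I_(n + n)) :=
  match split u with inl i => a i | inr i => k - (b (rev_ord i)).+2 end.
have phi_lt (u v : 'I_(n + n)) : u < v ->
    tnth (double_word p) u < tnth (double_word p) v -> phi u < phi v.
  rewrite /phi; case: split_ordP => i ->; case: split_ordP => j ->;
    rewrite ?tnth_double_lshift ?tnth_double_rshift /=.
  - by move=> ltij ltp; apply: (proj1 ha); rewrite /ascent ltij.
  (* Crossing the middle: an ascent from [i] to [rev_ord j] raises [a], which is at most [k - 2 - b]
     there; a descent from [rev_ord j] to [i] makes [b] smaller at [rev_ord j]. *)
  - move=> _ ltp; have := hab i; have := hab (rev_ord j).
    case: (ltngtP i (rev_ord j)) => [ltij|ltji|/val_inj eqij].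
    + by have := proj1 ha i (rev_ord j); rewrite /ascent ltij ltp => /(_ isT); lia.
    + by have := proj1 hb (rev_ord j) i; rewrite /descent ltji ltp => /(_ isT); lia.
    + by rewrite eqij ltnn in ltp.
  - by have := ltn_ord j; lia.
  - move=> ltij ltp; have := hab (rev_ord i).
    have := proj1 hb (rev_ord j) (rev_ord i); rewrite /descent ltp.
    have -> : rev_ord j < rev_ord i by move: (ltn_ord j) => /=; lia.
    by move=> /(_ isT); lia.
have phi_max u : (phi u).+1 < k.
  rewrite /phi; case: split => i; first by have := hab i; lia.
  by have := hab (rev_ord i); lia.
(* An occurrence would give [k] strictly increasing values of [phi], but only [k - 1] values are
   available. *)
have phi_ge m (ltmk : m < k) : m <= phi (f (Ordinal ltmk)).
  elim: m ltmk => [//|m IHm] ltmk.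
  have [|ltf ltw] := fP (Ordinal (ltnW ltmk)) (Ordinal ltmk); first by [].
  exact: leq_ltn_trans (IHm _) (phi_lt _ _ ltf ltw).
have ltk : k.-1 < k by lia.
by have := phi_ge _ ltk; have := phi_max (f (Ordinal ltk)); lia.
Qed.

End Avoid.

(** * Cells and standard fillings of a general shape *)

Lemma card_cell (lam : seq nat) : #|{: cell lam}| = sumn lam.
Proof.
rewrite card_tagged; congr sumn; apply: (@eq_from_nth _ 0) => [|i].
  by rewrite size_map size_enum_ord.
rewrite size_map size_enum_ord => lti.
rewrite (nth_map (Ordinal lti)) ?size_enum_ord // card_ord.
by rewrite nth_enum_ord.
Qed.

Lemma cell_inj (lam : seq nat) (c d : cell lam) :
  row_of c = row_of d -> col_of c = col_of d -> c = d.
Proof.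
case: c d => [i j] [i' j']; rewrite /row_of /col_of /= => /val_inj eqi.
by case: i' / eqi j' => j' /val_inj->.
Qed.

Lemma standardP (lam : seq nat) (T : filling lam) :
  reflect [/\ bijective T,
              forall c d, row_of c = row_of d -> col_of c < col_of d -> T c < T d
            & forall c d, col_of c = col_of d -> row_of c < row_of d -> T c < T d]
          (standard T).
Proof.
apply: (iffP and3P) => [[/forallP T1 /forallP Trow /forallP Tcol]|].
  split=> [|c d eqr ltc|c d eqc ltr].
  - apply: inj_card_bij => [c d eqT|]; last by rewrite card_cell card_ord.
    have /cards1P[x Tx] := T1 (T c).
    have : d \in [set x] by rewrite -Tx inE eqT.
    have : c \in [set x] by rewrite -Tx inE.
    by rewrite !inE => /eqP-> /eqP->.
  - by have /forallP/(_ d)/implyP := Trow c; apply; rewrite eqr eqxx.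
  - by have /forallP/(_ d)/implyP := Tcol c; apply; rewrite eqc eqxx.
move=> [[g Tg gT] Trow Tcol]; split.
- apply/forallP => v; apply/cards1P; exists (g v); apply/setP => c.
  by rewrite !inE; apply/eqP/eqP => [<-|->].
- apply/forallP => c; apply/forallP => d.
  by apply/implyP => /andP[/eqP eqr]; apply: Trow.
- apply/forallP => c; apply/forallP => d.
  by apply/implyP => /andP[/eqP eqc]; apply: Tcol.
Qed.

Lemma increasing_diagonalsP (lam : seq nat) (T : filling lam) :
  reflect (forall c d, row_of c = (row_of d).+1 -> col_of d = (col_of c).+1 ->
             T c < T d)
          (increasing_diagonals T).
Proof.
apply: (iffP forallP) => [Tdiag c d eqr eqc|Tdiag c].
  by have /forallP/(_ d)/implyP := Tdiag c; apply; rewrite eqr eqc !eqxx.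
by apply/forallP => d; apply/implyP => /andP[/eqP eqr /eqP]; apply: Tdiag.
Qed.

(** * Geometry of the staircase and monotonicity of its tableaux *)

Section Staircase.
Variable k : nat.

Lemma sumn_staircase : sumn (staircase k) = 'C(k, 2).
Proof.
rewrite sumn_rev sumnE -bin2_sum; case: k => [|m] /=; first by rewrite !big_nil.
by rewrite big_ltn // add0n /index_iota subn1.
Qed.

Lemma size_staircase : size (staircase k) = k.-1.
Proof. by rewrite size_rev size_iota. Qed.

Lemma nth_staircase (r : nat) : r < k.-1 -> nth 0 (staircase k) r = k.-1 - r.
Proof.
move=> ltr; rewrite nth_rev ?size_iota // nth_iota; lia.
Qed.

Lemma cell_bound (c : cell (staircase k)) : row_of c + col_of c < k.-1.
Proof.
case: c => [r j]; rewrite /row_of /col_of /=.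
have ltr : r < k.-1 by rewrite -size_staircase.
by have := ltn_ord j; rewrite [X in _ < X -> _]nth_staircase //; lia.
Qed.

Lemma mk_cell_row (r c : nat) : r + c < k.-1 -> r < size (staircase k).
Proof. by rewrite size_staircase; lia. Qed.

Lemma mk_cell_col (r c : nat) : r + c < k.-1 -> c < nth 0 (staircase k) r.
Proof. by move=> lt_rc; rewrite nth_staircase; lia. Qed.

(** Cells of the staircase become pairs subject to one symmetric inequality, with coordinates
    recovered by computation. *)
Definition mk_cell (r c : nat) (h : r + c < k.-1) : cell (staircase k) :=
  @existT _ (fun i : 'I__ => 'I_(nth 0 (staircase k) i))
    (Ordinal (mk_cell_row h)) (Ordinal (mk_cell_col h)).

Lemma flip_bound (c : cell (staircase k)) :
  k.-2 - (row_of c + col_of c) + col_of c < k.-1.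
Proof. by have := cell_bound c; lia. Qed.

(* Reflects each column; diagonals become rows. *)
Definition flip (c : cell (staircase k)) : cell (staircase k) :=
  mk_cell (flip_bound c).

Lemma row_flip (c : cell (staircase k)) :
  row_of (flip c) = k.-2 - (row_of c + col_of c).
Proof. by []. Qed.

Lemma col_flip (c : cell (staircase k)) : col_of (flip c) = col_of c.
Proof. by []. Qed.

Lemma flipK : involutive flip.
Proof.
move=> c; apply: cell_inj; rewrite ?row_flip ?col_flip //.
by have := cell_bound c; lia.
Qed.

Local Notation n := (sumn (staircase k)).
Local Notation tableau := (filling (staircase k)).

(** Pass through the corner [m] in the row of [c] and the column of [d]; it belongs to the shape
    because it lies weakly above [d]. *)
Lemma standard_mono (Q : tableau) (c d : cell (staircase k)) : standard Q ->
  row_of c <= row_of d -> col_of c <= col_of d -> c != d -> Q c < Q d.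
Proof.
move=> /standardP[Qbij Qrow Qcol] ler lec neq.
have lt_m : row_of c + col_of d < k.-1 by have := cell_bound d; lia.
pose m := mk_cell lt_m.
have leQm : Q c <= Q m.
  case: (ltngtP (col_of c) (col_of d)) lec => // [lt|eqc] _.
    by apply/ltnW/Qrow.
  by rewrite (_ : c = m) //; apply: cell_inj.
have leQd : Q m <= Q d.
  case: (ltngtP (row_of c) (row_of d)) ler => // [lt|eqr] _.
    by apply/ltnW/Qcol.
  by rewrite (_ : d = m) //; apply: cell_inj.
rewrite ltn_neqAle (leq_trans leQm leQd) andbT.
by apply: contraNneq neq => /val_inj /(bij_inj Qbij) ->.
Qed.

(** Go up the column of [c] to the row of [d], then right. After [flip] the first move goes down a
    column of [P] and the second goes up a diagonal, so entries grow along both. *)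
Lemma flip_mono (P : tableau) (c d : cell (staircase k)) :
    standard P -> increasing_diagonals P ->
    col_of c <= col_of d -> row_of d <= row_of c -> c != d ->
  P (flip c) < P (flip d).
Proof.
move=> /standardP[Pbij _ Pcol] /increasing_diagonalsP Pdiag lec ler neq.
have lt_m : row_of d + col_of c < k.-1 by have := cell_bound c; lia.
pose m := mk_cell lt_m.
have lePm : P (flip c) <= P (flip m).
  case: (ltngtP (row_of d) (row_of c)) ler => // [lt|eqr] _.
    apply/ltnW/Pcol => //; rewrite !row_flip.
    have -> : row_of m = row_of d by []. have -> : col_of m = col_of c by [].
    by have := cell_bound c; lia.
  by rewrite (_ : c = m) //; apply: cell_inj.
have lePd : P (flip m) <= P (flip d).
  have : col_of m <= col_of d by [].
  have : row_of m = row_of d by [].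
  (* The diagonal condition compares neighbours only, hence an induction on the number of columns
     still to cross. *)
  move: m {lePm} => m; move eqs : (col_of d - col_of m) => s.
  elim: s m eqs => [|s IHs] m eqs eqr lem.
    by rewrite (_ : m = d) //; apply: cell_inj => //; lia.
  have lt_m' : row_of m + (col_of m).+1 < k.-1 by have := cell_bound d; lia.
  have := IHs (mk_cell lt_m'); rewrite -[col_of (mk_cell _)]/(col_of m).+1.
  rewrite -[row_of (mk_cell _)]/(row_of m) => IH.
  apply: leq_trans (IH _ _ _); try by lia.
  apply/ltnW/Pdiag => //; rewrite !row_flip.
  rewrite -[col_of (mk_cell _)]/(col_of m).+1 -[row_of (mk_cell _)]/(row_of m).
  by have := cell_bound (mk_cell lt_m'); lia.
rewrite ltn_neqAle (leq_trans lePm lePd) andbT.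
by apply: contraNneq neq => /val_inj /(bij_inj Pbij) /(can_inj flipK) ->.
Qed.

(** * The correspondence between permutations and pairs of tableaux *)

Definition linked (p : 'S_n) (P Q : tableau) : Prop :=
  forall c, p (Q c) = P (flip c).

(** If an ascent failed to increase the column, then, depending on the rows, [Q] would reverse the
    positions or [P] the values. Descents are symmetric, with rows and columns exchanged. *)
Lemma tableau_heights (p : 'S_n) (P Q : tableau) (g : 'I_n -> cell (staircase k)) :
    standard P -> standard Q -> increasing_diagonals P -> linked p P Q ->
    cancel Q g -> cancel g Q ->
  height_fun (ascent p) (fun i => col_of (g i)) /\
  height_fun (descent p) (fun i => row_of (g i)).
Proof.
move=> stP stQ dP pPQ Qg gQ.
have neqg (i j : 'I_n) : i < j -> g j != g i.
  by apply: contraTneq => /(can_inj gQ) ->; rewrite ltnn.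
have pE i : p i = P (flip (g i)) by rewrite -pPQ gQ.
split; split=> [i j /andP[ltij ltp]|j h_gt0].
- rewrite ltnNge; apply/negP => lec.
  have [ler|/ltnW ler] := leqP (row_of (g j)) (row_of (g i)).
    by have := standard_mono stQ ler lec (neqg _ _ ltij); rewrite !gQ; lia.
  by have := flip_mono stP dP lec ler (neqg _ _ ltij); rewrite -!pE; lia.
(* The predecessor is the entry of [Q] in the left neighbour; for descents it will be the one in the
   cell above. *)
- have lt_m : row_of (g j) + (col_of (g j)).-1 < k.-1.
    by have := cell_bound (g j); lia.
  pose m := mk_cell lt_m.
  have ltm : col_of m < col_of (g j).
    by rewrite -[col_of m]/(col_of (g j)).-1; lia.
  have neqm : m != g j by apply: contraTneq ltm => ->; rewrite ltnn.
  exists (Q m); last by rewrite Qg -[col_of m]/(col_of (g j)).-1; lia.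
  have := standard_mono stQ (leqnn _ : row_of m <= row_of (g j)) (ltnW ltm) neqm.
  have := flip_mono stP dP (ltnW ltm) (leqnn _ : row_of (g j) <= row_of m) neqm.
  by rewrite gQ -pE -pPQ /ascent => -> ->.
- rewrite ltnNge; apply/negP => ler.
  have [lec|/ltnW lec] := leqP (col_of (g j)) (col_of (g i)).
    by have := standard_mono stQ ler lec (neqg _ _ ltij); rewrite !gQ; lia.
  have neq : g i != g j by rewrite eq_sym neqg.
  by have := flip_mono stP dP lec ler neq; rewrite -!pE; lia.
- have lt_m : (row_of (g j)).-1 + col_of (g j) < k.-1.
    by have := cell_bound (g j); lia.
  pose m := mk_cell lt_m.
  have ltm : row_of m < row_of (g j).
    by rewrite -[row_of m]/(row_of (g j)).-1; lia.
  have neqm : m != g j by apply: contraTneq ltm => ->; rewrite ltnn.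
  exists (Q m); last by rewrite Qg -[row_of m]/(row_of (g j)).-1; lia.
  have := standard_mono stQ (ltnW ltm) (leqnn _ : col_of m <= col_of (g j)) neqm.
  rewrite eq_sym in neqm.
  have := flip_mono stP dP (leqnn _ : col_of (g j) <= col_of m) (ltnW ltm) neqm.
  by rewrite gQ -pE -pPQ /descent => -> ->.
Qed.

Lemma linked_avoids (p : 'S_n) (P Q : tableau) : 0 < k ->
    standard P -> standard Q -> increasing_diagonals P -> linked p P Q ->
  avoids (double_word p) (1%g : 'S_k).
Proof.
move=> k_gt0 stP stQ dP pPQ; have [[g Qg gQ] _ _] := standardP _ stQ.
have [ha hb] := tableau_heights stP stQ dP pPQ Qg gQ.
by apply/(avoids_height ha hb k_gt0) => i; have := cell_bound (g i); lia.
Qed.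

Lemma linked_perm_unique (p p' : 'S_n) (P Q : tableau) : standard Q ->
  linked p P Q -> linked p' P Q -> p = p'.
Proof.
move=> /standardP[[g _ gQ] _ _] pPQ pPQ'.
by apply/permP => i; rewrite -(gQ i) pPQ pPQ'.
Qed.

Lemma linked_perm_exists (P Q : tableau) : standard P -> standard Q ->
  exists p, linked p P Q.
Proof.
move=> /standardP[/bij_inj Pinj _ _] /standardP[[g Qg gQ] _ _].
have finj : injective (fun i => P (flip (g i))).
  by move=> i j /Pinj /(can_inj flipK) /(can_inj gQ).
by exists (perm finj) => c; rewrite permE Qg.
Qed.

(** Both inverses of [Q] and [Q'] have the heights of [p] as coordinates, and heights are unique;
    then [p] and [Q] determine [P]. *)
Lemma linked_tableau_unique (p : 'S_n) (P Q P' Q' : tableau) :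
    standard P -> standard Q -> increasing_diagonals P -> linked p P Q ->
    standard P' -> standard Q' -> increasing_diagonals P' -> linked p P' Q' ->
  P = P' /\ Q = Q'.
Proof.
move=> stP stQ dP pPQ stP' stQ' dP' pPQ'.
have [[g Qg gQ] _ _] := standardP _ stQ; have [[g' Qg' gQ'] _ _] := standardP _ stQ'.
have [ha hb] := tableau_heights stP stQ dP pPQ Qg gQ.
have [ha' hb'] := tableau_heights stP' stQ' dP' pPQ' Qg' gQ'.
have eqg i : g i = g' i.
  by apply: cell_inj; [apply: (height_fun_unique hb hb')
                      | apply: (height_fun_unique ha ha')].
have eqQ : Q = Q' by apply/ffunP => c; rewrite -{1}(Qg' c) -eqg gQ.
split=> //; apply/ffunP => c.
by rewrite -(flipK c) -pPQ -pPQ' eqQ.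
Qed.

Lemma linked_tableau_exists (p : 'S_n) : 0 < k ->
    avoids (double_word p) (1%g : 'S_k) ->
  exists P, exists Q : tableau,
    [/\ standard P, standard Q, increasing_diagonals P & linked p P Q].
Proof.
move=> k_gt0 av.
(* Positions increase along either kind of chain and so bound its length. *)
have [|a ha] := @height_fun_exists _ (ascent p) val n _ (@ltn_ord n).
  by move=> i j /andP[].
have [|b hb] := @height_fun_exists _ (descent p) val n _ (@ltn_ord n).
  by move=> i j /andP[].
have ab_lt i : b i + a i < k.-1.
  by have := avoids_height ha hb k_gt0 av i; lia.
pose g i := mk_cell (ab_lt i).
have gcol i : col_of (g i) = a i by []. have grow i : row_of (g i) = b i by [].
have ginj : injective g.
  move=> i j eqg; apply/eqP; apply: contraT => neq.
  have eqa : a i = a j by rewrite -!gcol eqg.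
  have eqb : b i = b j by rewrite -!grow eqg.
  (* Two positions sharing a cell would each precede the other. *)
  have := pos_lt ha hb _ _ neq; rewrite eq_sym in neq.
  by have := pos_lt ha hb _ _ neq; rewrite eqa eqb; lia.
have [f gf fg] : bijective g by apply: inj_card_bij; rewrite // card_cell card_ord.
have af c : a (f c) = col_of c by rewrite -gcol fg.
have bf c : b (f c) = row_of c by rewrite -grow fg.
have neqf c d : col_of c != col_of d \/ row_of c != row_of d -> f c != f d.
  by move=> neq; apply/eqP => /(can_inj fg) eqcd; case: neq; rewrite eqcd eqxx.
exists [ffun c => p (f (flip c))], [ffun c => f c]; split.
- apply/standardP; split=> [|c d eqr ltc|c d eqc ltr]; last 2 first.
  (* Moving right in a row of [P] raises [a] and lowers [b] at the reflected cell; moving down a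
     column only lowers [b]. *)
  + rewrite !ffunE; apply: (val_lt ha hb); rewrite ?af ?bf ?row_flip ?col_flip; try lia.
    by apply: neqf; rewrite !col_flip; left; lia.
  + rewrite !ffunE; apply: (val_lt ha hb); rewrite ?af ?bf ?row_flip ?col_flip; try lia.
    by apply: neqf; rewrite !row_flip; right; have := cell_bound d; lia.
  exists (fun v => flip (g ((p^-1)%g v))) => [c|v]; rewrite ffunE.
    by rewrite permK fg flipK.
  by rewrite flipK gf permKV.
- apply/standardP; split=> [|c d eqr ltc|c d eqc ltr]; last 2 first.
  + rewrite !ffunE; apply: (pos_lt ha hb); rewrite ?af ?bf; try lia.
    by apply: neqf; left; lia.
  + rewrite !ffunE; apply: (pos_lt ha hb); rewrite ?af ?bf; try lia.
    by apply: neqf; right; lia.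
  by exists g => [c|v]; rewrite ffunE.
- apply/increasing_diagonalsP => c d eqr eqc; rewrite !ffunE.
  apply: (val_lt ha hb); rewrite ?af ?bf ?row_flip ?col_flip; try lia.
  by apply: neqf; rewrite !col_flip; left; lia.
- by move=> c; rewrite !ffunE flipK.
Qed.

End Staircase.

Theorem theorem3 (k : nat) (hk : 2 <= k) :
  r_avoid 'C(k, 2) (1%g : 'S_k) =
  #|[set PQ : filling (staircase k) * filling (staircase k) |
       [&& standard PQ.1, standard PQ.2 & increasing_diagonals PQ.1]]|.
Proof.
have k_gt0 : 0 < k by lia.
(* With [sumn (staircase k)] for the binomial, letters of permutations and tableau entries share one
   ordinal type. *)
rewrite -sumn_staircase r_avoidE; apply/eqP; rewrite eqn_leq; apply/andP; split.
  apply: (@leq_card_rel _ _ _ _ (fun p PQ => linked p PQ.1 PQ.2)).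
    move=> p; rewrite inE => /(linked_tableau_exists k_gt0)[P [Q [stP stQ dP pPQ]]].
    by exists (P, Q); rewrite ?inE /= ?stP ?stQ.
  move=> p p' [P Q] _ _; rewrite inE /= => /and3P[_ stQ _].
  exact: linked_perm_unique.
apply: (@leq_card_rel _ _ _ _ (fun PQ p => linked p PQ.1 PQ.2)).
  move=> [P Q]; rewrite inE /= => /and3P[stP stQ dP].
  have [p pPQ] := linked_perm_exists stP stQ.
  by exists p; rewrite ?inE //; apply: linked_avoids pPQ.
move=> [P Q] [P' Q'] p; rewrite !inE /= => /and3P[stP stQ dP] /and3P[stP' stQ' dP'] _.
move=> pPQ pPQ'.
by have [-> ->] := linked_tableau_unique stP stQ dP pPQ stP' stQ' dP' pPQ'.
Qed.
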